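(* Let $V\subseteq\mathbb{N}_0^n$ be nonempty, and for $1\le i\le n$ let $(\mathcal{G}^{(i)}_n,m_i)=(V,E^{(i)}_n)\in\mathscr{X}(V)$ be generalized directed semi-trees with associated polynomials $p_i$, such that for some $k>0$, $\mathrm{card}(\mathrm{Par}^{(i)}_n(\mathbf v))\le k$ for all $\mathbf v\in V$ and $1\le i\le n$. Let $\{S_{\mathbf v}\}_{\mathbf v\in V}$ be polynomials satisfying (i) and (ii) of the context, let $\{\beta(\mathbf v)\}_{\mathbf v\in V}$ be positive numbers, and let $\mathscr{H}^2(\beta)$ and $T_{p_1},\dots,T_{p_n}$ be the corresponding Hilbert space of formal power series and multiplication operators. For $1\le i\le n$ let $\Lambda_i$ be the weighted shift on $(\mathcal{G}^{(i)}_n,m_i)$ given, for $f\in\mathcal{D}(\Lambda_i)\subseteq\ell^2(V)$, by $$(\Lambda_if)(\mathbf v)=\begin{cases}0,&\mathbf v\in\mathrm{Root}(\mathcal{G}^{(i)}_n),\\ \displaystyle\sum_{\mathbf u\in\mathrm{Par}^{(i)}_n(\mathbf v)}\frac{\beta(\mathbf v)}{\beta(\mathbf u)}f(\mathbf u),&\text{otherwise.}\end{cases}$$ Suppose that each $\Lambda_i$ extends to a bounded linear operator on $\ell^2(V)$ and that the $n$-tuple $(\Lambda_1,\dots,\Lambda_n)$ is commuting. Then there exists a unitary operator $U:\ell^2(V)\to\mathscr{H}^2(\beta)$ such that $U^*T_{p_i}U=\Lambda_i$ for each $1\le i\le n$.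
   Context: $\mathbb{N}$ is the set of natural numbers (positive integers) and $\mathbb{N}_0=\mathbb{N}\cup\{0\}$. A directed graph is $(V,E)$ with $E\subseteq(V\times V)\setminus\{(v,v):v\in V\}$; $\mathrm{Chi}(u)=\{v:(u,v)\in E\}$, $\mathrm{Par}(u)=\{v:(v,u)\in E\}$, and $\mathrm{Root}(\mathcal{G})=\{v:\mathrm{Par}(v)=\emptyset\}$. It is a generalized directed semi-tree if it has no circuit (distinct vertices $v_1,\dots,v_r$, $r\ge2$, with $(v_j,v_{j+1})\in E$ for $j<r$ and $(v_r,v_1)\in E$), has at most countably many connected components, and there is a non-negative integer $l$ with $\mathrm{card}(\mathrm{Chi}(u)\cap\mathrm{Chi}(v))\le l$ for all distinct $u,v$; it is denoted $(\mathcal{G},l)$ with $l$ the least such integer. For $V\subseteq\mathbb{N}_0^n$, $\mathscr{X}(V)$ is the set of generalized directed semi-trees $(\mathcal{G},l)=(V,E)$ such that: (1) if $(\mathbf v,\mathbf u)\in E$ then $v_j\le u_j$ for $j=1,\dots,n$; (2) there is a natural number $m$ with $\mathrm{card}(\mathrm{Chi}(\mathbf u))\le m$ for all $\mathbf u\in V$ and $V_m=\{\mathbf v\in V:\mathrm{card}(\mathrm{Chi}(\mathbf v))=m\}\neq\emptyset$, such that (a) for any $\mathbf v,\mathbf v'\in V_m$ and $\mathbf u\in\mathrm{Chi}(\mathbf v)$ there is a unique $\mathbf u'\in\mathrm{Chi}(\mathbf v')$ with $\mathbf u-\mathbf v=\mathbf u'-\mathbf v'$; hence the set $\deg(\mathcal{G})=\{\mathbf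 u-\mathbf v:\mathbf u\in\mathrm{Chi}(\mathbf v)\}=\{\mathbf{k}^{(1)},\dots,\mathbf{k}^{(m)}\}$ does not depend on $\mathbf v\in V_m$; (b) for every $\mathbf u\in V$ and $\mathbf w\in\mathrm{Chi}(\mathbf u)$ there is a unique $\mathbf k\in\deg(\mathcal{G})$ with $\mathbf w-\mathbf u=\mathbf k$. The polynomial associated to $(\mathcal{G},l)$ is $p_{\mathcal{G}}(z_1,\dots,z_n)=\sum_{i=1}^m z_1^{k^{(i)}_1}\cdots z_n^{k^{(i)}_n}$. For $(\mathcal{G}^{(i)}_n,m_i)=(V,E^{(i)}_n)$, write $\mathrm{Chi}^{(i)}_n(\mathbf v)$ and $\mathrm{Par}^{(i)}_n(\mathbf v)$ for the sets of children and parents of $\mathbf v$, and $p_i$ for the associated polynomial. The polynomials $S_{\mathbf v}$, $\mathbf v\in V$, are required to satisfy: (i) $S_{\mathbf v}=\sum_{|\mathbf a|\le|\mathbf v|,\ \mathbf a\in\mathbb{N}_0^n}c_{\mathbf a}\,p_1^{a_1}\cdots p_n^{a_n}$ for some $c_{\mathbf a}\in\mathbb{C}$ (depending on $\mathbf v$), where $|\mathbf a|=\sum_i a_i$; (ii) $p_i\cdot S_{\mathbf v}=\sum_{\mathbf u\in\mathrm{Chi}^{(i)}_n(\mathbf v)}S_{\mathbf u}$ for all $i$ and $\mathbf v$. $\mathscr{H}^2(\beta)$ is the Hilbert space of formal series $f=\sum_{\mathbf v\in V}\hat f(\mathbf v)S_{\mathbf v}$ with $\sum_{\mathbf v}|\hat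 f(\mathbf v)|^2\beta(\mathbf v)^2<\infty$ and inner product $\langle f,g\rangle=\sum_{\mathbf v}\hat f(\mathbf v)\overline{\hat g(\mathbf v)}\beta(\mathbf v)^2$; thus $\{S_{\mathbf v}/\beta(\mathbf v)\}$ is an orthonormal basis. The operator $T_{p_i}f=p_if$ is formal multiplication using (ii), that is, $T_{p_i}f=\sum_{\mathbf v\in V}\big(\sum_{\mathbf u\in\mathrm{Par}^{(i)}_n(\mathbf v)}\hat f(\mathbf u)\big)S_{\mathbf v}$. $\ell^2(V)$ is the Hilbert space of square-summable complex functions on $V$. $\mathcal{D}(\Lambda_i)$ is the set of $f\in\ell^2(V)$ for which the function $\Lambda_if$ defined by the displayed formula lies in $\ell^2(V)$. *)

(* Defs.v *)
From HB Require Import structures.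
From mathcomp Require Import all_boot all_order all_algebra.
From mathcomp Require Import finmap complex mpoly.
From mathcomp Require Import boolp classical_sets functions cardinality fsbigop.
From mathcomp Require Import reals ereal topology normedtype esum summability.
From mathcomp Require Import ring.

Set Implicit Arguments.
Unset Strict Implicit.
Unset Printing Implicit Defensive.

Import Order.TTheory GRing.Theory Num.Theory numFieldNormedType.Exports.
Import ComplexField Normc.

Local Open Scope classical_set_scope.
Local Open Scope card_scope.
Local Open Scope complex_scope.
Local Open Scope ring_scope.

Section Digraph.
Context {T : choiceType}.
Implicit Types (E : set (T * T)) (u v : T).

Definition loopless E := forall v, ~ E (v, v).

Definition Chi E u : set T := [set v | E (u, v)].
Definition Par E u : set T := [set v | E (v, u)].
Definition Root E : set T := [set v | Par E v = set0].

Definition circuit E (c : seq T) :=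
  [/\ (2 <= size c)%N, uniq c & cycle (fun u v => `[< E (u, v) >]) c].

Definition component E v : set T :=
  [set u | exists p, path (fun x y => `[< E (x, y) \/ E (y, x) >]) v p
                     /\ last v p = u].

Definition common_children_le E (l : nat) :=
  forall u v, u <> v -> Chi E u `&` Chi E v #<= `I_l.

(* [semi_tree E l] is the pair (G, l): [l] is the least admissible bound. *)
Definition semi_tree E (l : nat) :=
  [/\ loopless E,
      forall c, ~ circuit E c,
      countable (range (component E)),
      common_children_le E l &
      forall l', common_children_le E l' -> (l <= l')%N].

Definition max_outdegree E (m : nat) :=
  [/\ (0 < m)%N, forall u, Chi E u #<= `I_m & exists v, Chi E v #= `I_m].

End Digraph.

Section SemiTreesInNn.
Context {n : nat} {V : set 'X_{1..n}}.
Implicit Types (E : set (V * V)) (u v w : V) (k : 'X_{1..n}).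

Definition monotone_edges E :=
  forall v u, E (v, u) -> (val v <= val u)%MM.

(* Subtraction on ['X_{1..n}] is truncated; below it is only applied along
   edges, where it is the true difference as soon as [monotone_edges E]. *)
Definition deg E : set 'X_{1..n} :=
  [set k | exists m v u, [/\ max_outdegree E m, Chi E v #= `I_m, Chi E v u &
                             (val u - val v)%MM = k]].

Definition semi_tree_class E (l : nat) :=
  [/\ semi_tree E l,
      monotone_edges E &
      exists m, [/\ max_outdegree E m,
        forall v v' u, Chi E v #= `I_m -> Chi E v' #= `I_m -> Chi E v u ->
          exists! u', Chi E v' u' /\
                      (val u - val v)%MM = (val u' - val v')%MM &
        forall u w, Chi E u w ->
          exists! k, deg E k /\ (val w - val u)%MM = k]].

(* [deg E] is finite when [semi_tree_class E l], so this is a genuine sum. *)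
Definition assoc_poly (R : realType) E : {mpoly R[i][n]} :=
  \sum_(k \in deg E) ('X_[k] : {mpoly R[i][n]}).

End SemiTreesInNn.

Section WeightedL2.
Context {R : realType} {T : choiceType}.
Implicit Types (w : T -> R) (f g : T -> R[i]^o).

Definition sqsum w f : \bar R :=
  \esum_(v in [set: T]) (normc (f v) ^+ 2 * w v ^+ 2)%:E.

Definition wl2_pred w : {pred (T -> R[i]^o)} := fun f => `[< (sqsum w f < +oo)%E >].

Lemma sqsum_ge0 w f : (0 <= sqsum w f)%E.
Proof. by apply: esum_ge0 => v _; rewrite lee_fin mulr_ge0 ?sqr_ge0. Qed.

Lemma sqsum0 w : sqsum w 0 = 0%E.
Proof. by rewrite /sqsum esum1// => v _; rewrite normc0 expr0n mul0r. Qed.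

Lemma esumZl_le (a : T -> \bar R) (r : R) : (0 <= r) -> (forall v, 0 <= a v)%E ->
  (\esum_(v in [set: T]) (r%:E * a v) <= r%:E * \esum_(v in [set: T]) a v)%E.
Proof.
move=> r0 a0; apply: ge_ereal_sup => _ [F [finF FT] <-].
rewrite -ge0_mule_fsumr//; apply: lee_wpmul2l; first by rewrite lee_fin.
by apply: ereal_sup_ubound; exists F.
Qed.

Lemma sqsumP w (c : R[i]) f g :
  (sqsum w (c *: f + g)%R
   <= (2 * normc c ^+ 2)%:E * sqsum w f + 2%:E * sqsum w g)%E.
Proof.
pose h k v := (normc (k v) ^+ 2 * w v ^+ 2)%:E : \bar R.
have h0 k v : (0 <= h k v)%E by rewrite lee_fin mulr_ge0 ?sqr_ge0.
have c0 : 0 <= 2 * normc c ^+ 2 by rewrite mulr_ge0 ?sqr_ge0.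
apply: (@le_trans _ _ (\esum_(v in [set: T])
    ((2 * normc c ^+ 2)%:E * h f v + 2%:E * h g v))%E); last first.
  rewrite esumD; last 2 first.
  - by move=> v _; apply: mule_ge0 (h0 _ _); rewrite lee_fin.
  - by move=> v _; apply: mule_ge0 (h0 _ _); rewrite lee_fin.
  by apply: leeD; apply: esumZl_le.
apply: le_esum => v _; rewrite -!EFinM -EFinD lee_fin.
rewrite [leRHS](_ : _ = (2 * normc c ^+ 2 * normc (f v) ^+ 2 +
    2 * normc (g v) ^+ 2) * w v ^+ 2); last by ring.
apply: ler_wpM2r; first exact: sqr_ge0.
set x := normc c * normc (f v); set y := normc (g v).
have normc_ge0' (z : R[i]) : 0 <= normc z by case: z => a b; exact: sqrtr_ge0.
have xyE : normc ((c *: f + g) v : R[i]) <= x + y.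
  by apply: le_trans (le_normcD _ _) _; rewrite normcM.
apply: (@le_trans _ _ ((x + y) ^+ 2)).
  apply: lerXn2r => //; rewrite nnegrE; first exact: normc_ge0'.
  by rewrite addr_ge0 ?mulr_ge0 ?normc_ge0'.
have -> : 2 * normc c ^+ 2 * normc (f v) ^+ 2 + 2 * y ^+ 2
          = (x + y) ^+ 2 + (x - y) ^+ 2.
  by rewrite /x; ring.
by rewrite lerDl sqr_ge0.
Qed.

Fact wl2_submod_closed w : submod_closed (wl2_pred w).
Proof.
split=> [|c f g /asboolP fP /asboolP gP]; first by apply/asboolP; rewrite sqsum0.
apply/asboolP; apply: le_lt_trans (sqsumP w c f g) _.
by apply: lte_add_pinfty; apply: lte_mul_pinfty => //;
  rewrite lee_fin // mulr_ge0 // sqr_ge0.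
Qed.

HB.instance Definition _ w :=
  GRing.isSubmodClosed.Build R[i] (T -> R[i]^o) (wl2_pred w) (wl2_submod_closed w).

Record wl2 w := Wl2 { wl2_val :> T -> R[i]^o; _ : wl2_val \in wl2_pred w }.

HB.instance Definition _ w := [isSub of wl2 w for @wl2_val w].
HB.instance Definition _ w := [Choice of wl2 w by <:].
HB.instance Definition _ w := [SubChoice_isSubLmodule of wl2 w by <:].

Definition inner w (f g : wl2 w) : R[i] :=
  summability.sum (fun v => (f v * (g v)^*%C * (w v ^+ 2)%:C) : R[i]^o).

Definition wl2_norm w (f : wl2 w) : R := Num.sqrt (fine (sqsum w f)).

End WeightedL2.

Lemma sum_nneg (R : realType) (T : choiceType) (a : T -> R) :
  (forall v, 0 <= a v) -> (\esum_(v in [set: T]) (a v)%:E < +oo)%E ->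
  summability.sum (fun v => (a v)%:C : R[i]^o) =
  (fine (\esum_(v in [set: T]) (a v)%:E))%:C.
Proof.
move=> a0 afin; set s := esum _ _ in afin *.
have s0 : (0 <= s)%E by apply: esum_ge0 => v _; rewrite lee_fin.
have sE : s = (fine s)%:E by rewrite fineK // ge0_fin_numE.
have pE (A : {fset T}) : partial_sum (fun v => (a v)%:C : R[i]^o) A =
    (\sum_(v <- A) a v)%:C.
  rewrite /partial_sum rmorph_sum /= big_seq_fsetE; exact: eq_bigr.
have pleE (A : {fset T}) : ((\sum_(v <- A) a v)%:E <= s)%E.
  apply: ereal_sup_ubound; exists [set` A]; first by split=> //; exact: finite_fset.
  by rewrite -sumEFin fsbig_finite //= set_fsetK.
have ? : ProperFilter (@totally T) := totally_filter.
apply/cvg_lim; first exact: norm_hausdorff.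
apply/cvgrPdist_le => /= e e0.
have [r r0 re] : exists2 r : R, 0 < r & e = r%:C.
  case: e e0 => x y; rewrite ltcE /= => /andP[/eqP y0 x0].
  by exists x => //; rewrite y0.
have : ((fine s - r)%:E < s)%E by rewrite [ltRHS]sE lte_fin ltrBlDr ltrDl.
move=> /ereal_sup_gt[_ [F [finF _] <-]] Flt.
exists (fset_set F) => // A /= FA.
rewrite pE -rmorphB /= normc_def /= expr0n addr0 sqrtr_sqr re lecR.
have As := pleE A; rewrite sE lee_fin in As.
rewrite ger0_norm ?subr_ge0 // lerBlDl -lerBlDr; apply: ltW.
rewrite -lte_fin; apply: lt_le_trans Flt _.
rewrite fsbig_finite //= sumEFin lee_fin.
rewrite [leRHS](big_fsetID _ (mem (fset_set F))) /=.
rewrite [X in X + _](_ : _ = \sum_(i <- fset_set F) a i).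
  by rewrite lerDl sumr_ge0.
apply: eq_fbigl => v; rewrite !inE /= andbC.
by case: (boolP (v \in _)) => //= vF; exact: (fsubsetP FA).
Qed.

Lemma inner_norm (R : realType) (T : choiceType) (w : T -> R) (f : wl2 w) :
  inner f f = (wl2_norm f ^+ 2)%:C.
Proof.
have /asboolP fw : (f : T -> R[i]^o) \in wl2_pred w by case: f.
rewrite /wl2_norm sqr_sqrtr ?fine_ge0 ?sqsum_ge0 // /inner /sqsum.
rewrite -sum_nneg //; last by move=> v; rewrite mulr_ge0 ?sqr_ge0.
apply: (congr1 (fun h : T -> R[i]^o => summability.sum h)); apply/funext => v /=.
rewrite [RHS]rmorphM; congr (_ * _).
move: (f v : R[i]) => z; rewrite -[LHS](sqr_normc z).
by rewrite [RHS]rmorphXn normc_def; case: z.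
Qed.

(* An operator with a possibly proper domain is represented by its graph, so
   that an equality of graphs includes the equality of the domains. *)
Definition op_graph (A B : Type) (F : A -> B) : set (A * B) :=
  [set xy | xy.2 = F xy.1].

Section Operators.
Context {R : realType} {T : choiceType}.
Implicit Types (w beta : T -> R) (E : set (T * T)).

Definition bounded_op w w' (F : wl2 w -> wl2 w') :=
  exists M : R, forall f, wl2_norm (F f) <= M * wl2_norm f.

Definition unitary w w' (U : wl2 w -> wl2 w') (Ustar : wl2 w' -> wl2 w) :=
  [/\ forall f g, inner (U f) g = inner f (Ustar g),
      cancel U Ustar & cancel Ustar U].

Definition l2 : lmodType R[i] := wl2 (fun _ : T => 1 : R).

(* The formal series [\sum_v f v * S v] is represented by its coefficient
   family [f]; only the weight [beta] enters the Hilbert space structure. *)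
Definition H2 beta : lmodType R[i] := wl2 beta.

Definition mul_graph beta E : set (H2 beta * H2 beta) :=
  [set fg | forall v, (fg.2 : wl2 _) v = \sum_(u \in Par E v) (fg.1 : wl2 _) u].

Definition shift_graph beta E : set (l2 * l2) :=
  [set fg | forall v, (fg.2 : wl2 _) v =
     if v \in Root E then 0
     else \sum_(u \in Par E v) (beta v / beta u)%:C * (fg.1 : wl2 _) u].

End Operators.
Arguments l2 R T : clear implicits.
Arguments mul_graph {R T} beta E.

(* Main.v *)
Require Import Defs.
From HB Require Import structures.
From mathcomp Require Import all_boot all_order all_algebra.
From mathcomp Require Import complex mpoly.
From mathcomp Require Import boolp classical_sets functions cardinality fsbigop.
From mathcomp Require Import reals ereal topology normedtype esum.

Set Implicit Arguments.
Unset Strict Implicit.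
Unset Printing Implicit Defensive.

Import Order.TTheory GRing.Theory Num.Theory numFieldNormedType.Exports.

Local Open Scope classical_set_scope.
Local Open Scope card_scope.
Local Open Scope complex_scope.
Local Open Scope ring_scope.

(** The weighted shift is multiplication read in the orthonormal basis
    [S_v / beta v].  Let [U] divide the [v]-th coordinate by [beta v].  The pair
    [(U f, U g)] is in the graph of multiplication exactly when, for all [v],
    [g v / beta v] is the sum of [f u / beta u] over the parents [u] of [v], and
    clearing [beta v] gives the formula of the shift ([rescale_mul_graph]).  [U]
    is unitary because it compensates for the weight coordinate by coordinate
    ([rescale_unitary]).  Hence the conjugate of multiplication by [U] equals
    the maximal shift, domains included.

    It remains to see that the maximal shift has full domain, so that the
    bounded operator extending it is the shift itself
    ([shift_graph_of_bounded]).  Let [M] bound the operator and take [f] in l2.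
    Each vertex has finitely many parents, so on a finite set [G] of vertices
    the shift of [f] only sees the finite set [F] of parents of [G], and agrees
    there with the shift of the truncation of [f] to [F].  That truncation has
    finite support and each vertex has finitely many children, so its shift has
    finite support too: it lies in the domain, where the bound holds.  Thus the
    square sum over [G] is at most [M^2 * ||f||^2], uniformly in [G]. *)

(** * Square sums *)

Section SquareSums.
Context {R : realType} {T : choiceType}.
Implicit Types (w : T -> R) (f g : T -> R[i]^o).

Lemma wl2_sqsum_fin w (f : wl2 w) : (sqsum w f < +oo)%E.
Proof. by have /asboolP : (f : T -> R[i]^o) \in wl2_pred w by case: f. Qed.

Lemma wl2_norm_sqr w (f : wl2 w) : (wl2_norm f ^+ 2)%:E = sqsum w f.
Proof.
rewrite /wl2_norm sqr_sqrtr ?fine_ge0 ?sqsum_ge0 // fineK //.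
by rewrite ge0_fin_numE ?sqsum_ge0 // wl2_sqsum_fin.
Qed.

Lemma eq_wl2 w (f g : wl2 w) : (forall v, f v = g v) -> f = g.
Proof. by move=> fg; apply: val_inj; apply/funext. Qed.

Lemma sqsum_patch_le w f (F : set T) :
  (sqsum w (patch (fun=> 0%R) F f) <= sqsum w f)%E.
Proof.
apply: le_esum => v _; rewrite lee_fin /patch; case: ifP => // _.
by rewrite Normc.normc0 expr0n mul0r mulr_ge0 ?sqr_ge0.
Qed.

Lemma sqsum_finite_support w f (F : set T) :
  finite_set F -> (forall v, ~ F v -> f v = 0) -> (sqsum w f < +oo)%E.
Proof.
move=> finF f0; rewrite /sqsum.
rewrite (_ : esum _ _ = \esum_(v in F) (Normc.normc (f v) ^+ 2 * w v ^+ 2)%:E).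
  rewrite esum_fset //; last by move=> v _; rewrite lee_fin mulr_ge0 ?sqr_ge0.
  by rewrite fsbig_finite //= sumEFin ltry.
rewrite [RHS]esum_mkcond; apply: eq_esum => v _.
case: ifPn => // /negP vF; rewrite f0 ?Normc.normc0 ?expr0n ?mul0r //.
by move=> Fv; apply: vF; rewrite inE.
Qed.

(** Square sums are suprema of finite partial sums, so a bound that holds for
    functions agreeing with [f] on each finite set holds for [f]. *)
Lemma sqsum_le_local w f (C : \bar R) :
  (forall G, finite_set G ->
     exists2 g, {in G, f =1 g} & (sqsum w g <= C)%E) ->
  (sqsum w f <= C)%E.
Proof.
move=> loc; apply: ge_ereal_sup => _ [G [finG _] <-].
have [g fg gC] := loc G finG; apply: le_trans gC; apply: esum_ge.
exists G; first by split.
by under eq_fsbigr => v vG do rewrite fg //.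
Qed.

End SquareSums.

(** * Change of weight *)

Section Rescale.
Context {R : realType} {T : choiceType} {w w' : T -> R}.
Hypothesis w'_neq0 : forall v, w' v != 0.
Implicit Types f g : wl2 w.

(** The weights are arranged so that [(w v / w' v) * w' v = w v]: rescaling
    preserves the weighted modulus of each coordinate. *)
Definition rescale_fun (f : wl2 w) : T -> R[i]^o :=
  fun v => (w v / w' v)%:C * (f v : R[i]).

Lemma rescale_subproof f : rescale_fun f \in wl2_pred w'.
Proof.
apply/asboolP; rewrite (_ : sqsum _ _ = sqsum w f) ?wl2_sqsum_fin //.
apply: eq_esum => v _; congr _%:E.
have -> : Normc.normc (rescale_fun f v) =
    `|w v / w' v| * Normc.normc (f v : R[i]).
  by rewrite Normc.normcM /= expr0n addr0 sqrtr_sqr.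
rewrite exprMn real_normK ?num_real // exprMn exprVn.
by rewrite mulrAC divfK ?expf_neq0 // mulrC.
Qed.

Definition rescale f : wl2 w' := Wl2 (rescale_subproof f).

Lemma rescale_is_linear : linear rescale.
Proof.
move=> a f g; apply: eq_wl2 => v /=.
rewrite /rescale_fun /=.
rewrite [LHS]mulrDr; congr (_ + _).
exact: mulrCA.
Qed.

HB.instance Definition _ :=
  GRing.isLinear.Build R[i] (wl2 w) (wl2 w') _ rescale rescale_is_linear.

End Rescale.

Section RescaleUnitary.
Context {R : realType} {T : choiceType} {w w' : T -> R}.
Hypotheses (w_neq0 : forall v, w v != 0) (w'_neq0 : forall v, w' v != 0).

Lemma rescaleK : cancel (rescale w'_neq0) (rescale (w := w') w_neq0).
Proof.
move=> f; apply: eq_wl2 => v /=; rewrite /rescale_fun /= /rescale_fun mulrA.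
rewrite -rmorphM /= mulrA divfK // divff //.
exact: mul1r.
Qed.

Lemma inner_rescale (f : wl2 w) (g : wl2 w') :
  inner (rescale w'_neq0 f) g = inner f (rescale w_neq0 g).
Proof.
rewrite /inner.
apply: (congr1 (fun h : T -> R[i]^o => summability.sum h)).
apply/funext => v /=.
have conjE (c : R) (z : R[i]) : (c%:C * z)^*%C = c%:C * z^*%C.
  by rewrite [LHS]rmorphM; congr (_ * _); exact: conjc_real.
have swap : (w v / w' v)%:C * (w' v ^+ 2)%:C =
            (w' v / w v)%:C * (w v ^+ 2)%:C :> R[i].
  by rewrite -!rmorphM /= !expr2 !mulrA !divfK // mulrC.
rewrite /rescale_fun conjE.
set x := (f v : R[i]); set y := (g v)^*%C.
rewrite -!mulrA mulrCA [y * _]mulrC [X in x * X]mulrA.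
by rewrite swap -mulrA [_%:C * y]mulrC.
Qed.

End RescaleUnitary.

Lemma rescale_unitary (R : realType) (T : choiceType) (w w' : T -> R)
    (w_neq0 : forall v, w v != 0) (w'_neq0 : forall v, w' v != 0) :
  unitary (rescale (w := w) w'_neq0) (rescale (w := w') w_neq0).
Proof. by split; [exact: inner_rescale | exact: rescaleK | exact: rescaleK]. Qed.

(** * Weighted shifts *)

Section Shift.
Context {R : realType} {T : choiceType} (beta : T -> R) (E : set (T * T)).

Definition shift_fun (f : T -> R[i]^o) : T -> R[i]^o :=
  fun v => \sum_(u \in Par E v) (beta v / beta u)%:C * (f u : R[i]).

(** At a root the sum over the parents is empty, so one formula covers both
    cases. *)
Lemma shift_graphE (f g : l2 R T) :
  shift_graph beta E (f, g) <->
  forall v, (g : wl2 _) v = shift_fun (f : wl2 _) v.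
Proof.
have rootE v : (if v \in Root E then 0 else shift_fun (f : wl2 _) v) =
    shift_fun (f : wl2 _) v.
  by case: ifP => //; rewrite inE /shift_fun => ->; rewrite fsbig_set0.
by split => fg v; have := fg v; rewrite /= rootE.
Qed.

Lemma shift_fun_support (f : T -> R[i]^o) (F : set T) v :
  (forall u, ~ F u -> f u = 0) -> ~ (\bigcup_(u in F) Chi E u) v ->
  shift_fun f v = 0.
Proof.
move=> f0 vF; apply: fsbig1 => u uv; rewrite f0 ?mulr0 // => Fu.
by apply: vF; exists u.
Qed.

Lemma eq_shift_fun (f g : T -> R[i]^o) v :
  {in Par E v, f =1 g} -> shift_fun f v = shift_fun g v.
Proof. by move=> fg; apply: eq_fsbigr => u uv; rewrite fg. Qed.

Hypotheses (Par_fin : forall v, finite_set (Par E v))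
           (Chi_fin : forall v, finite_set (Chi E v)).

(** Finite sets of parents make the value of the shift at a vertex depend on
    finitely many coordinates, and finite sets of children put every finitely
    supported function in the domain; together they let the bound pass from
    truncations of [f] to [f] itself, which is thus in the domain. *)
Lemma shift_graph_of_bounded (L : l2 R T -> l2 R T) :
  bounded_op L -> shift_graph beta E `<=` op_graph L ->
  shift_graph beta E = op_graph L.
Proof.
move=> [M LM] ext; apply/seteqP; split => // -[f g]; rewrite /op_graph /= => ->.
have shift_in_l2 : shift_fun (f : wl2 _) \in wl2_pred (fun=> 1).
  apply/asboolP.
  apply: (@le_lt_trans _ _ ((M * wl2_norm (f : wl2 _)) ^+ 2)%:E);
    last exact: ltry.
  apply: sqsum_le_local => G finG.
  (* The coordinates of [f] on which the shift of [f] over [G] depends. *)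
  pose F := \bigcup_(v in G) Par E v.
  pose h : T -> R[i]^o := patch (fun=> 0) F (f : wl2 _).
  have h0 u : ~ F u -> h u = 0 by move=> Fu; rewrite /h patchC // inE.
  have hfin := le_lt_trans (sqsum_patch_le _ _ F) (wl2_sqsum_fin f).
  pose hl : l2 R T := @Wl2 _ _ (fun=> 1) h (asboolT hfin).
  have finF : finite_set F by exact: bigcup_finite.
  have shift_hfin : (sqsum (fun=> 1%R) (shift_fun h) < +oo)%E.
    apply: (@sqsum_finite_support _ _ _ _ (\bigcup_(u in F) Chi E u)).
      exact: bigcup_finite.
    by move=> v; exact: shift_fun_support.
  pose shift_hl : l2 R T :=
    @Wl2 _ _ (fun=> 1) (shift_fun h) (asboolT shift_hfin).
  have shift_hlE : shift_hl = L hl.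
    by apply: (ext (hl, shift_hl)); apply/shift_graphE => v.
  exists (shift_fun h) => [v|].
    rewrite inE => Gv; apply: eq_shift_fun => u; rewrite inE => uv.
    by rewrite /h patchT // inE; exists v.
  rewrite -[shift_fun h]/(wl2_val shift_hl) -wl2_norm_sqr lee_fin shift_hlE.
  apply: (@le_trans _ _ ((M * wl2_norm (hl : wl2 _)) ^+ 2)).
    have := LM hl; have n0 : 0 <= wl2_norm (L hl) by exact: sqrtr_ge0.
    by move=> le; rewrite lerXn2r // nnegrE // (le_trans n0 le).
  rewrite !exprMn ler_wpM2l ?sqr_ge0 // -lee_fin !wl2_norm_sqr.
  exact: sqsum_patch_le.
have gr : shift_graph beta E (f, Wl2 shift_in_l2 : l2 R T).
  by apply/shift_graphE.
by have /= <- := ext _ gr.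
Qed.

Hypothesis beta_neq0 : forall v, beta v != 0.

(** Both inclusions multiply or divide one pointwise identity by [beta v], and
    membership in the weighted spaces is carried along by the bijection [U], so
    the domains agree as well. *)
Lemma rescale_mul_graph (one_neq0 : forall _ : T, (1 : R) != 0) :
  let U : l2 R T -> H2 beta := rescale (w := fun=> 1) beta_neq0 in
  let Ustar : H2 beta -> l2 R T := rescale (w := beta) one_neq0 in
  (op_graph Ustar \; mul_graph beta E \; op_graph U)%relation =
  shift_graph beta E.
Proof.
move=> U Ustar.
have sumE (f : l2 R T) v : \sum_(u \in Par E v) ((U f : wl2 _) u : R[i]) =
    (beta v)^-1%:C * shift_fun (f : wl2 _) v.
  rewrite /shift_fun mulr_fsumr; apply: eq_fsbigr => u _.
  by rewrite mulrA -rmorphM /= mulrA mulVf.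
apply/seteqP; split => -[f g]; rewrite /op_graph /mul_graph /=.
  move=> [a [a' -> mulE] ->]; apply/shift_graphE => v.
  rewrite /= /rescale_fun mulE /= sumE mulrA -rmorphM /= divr1 mulfV //.
  exact: mul1r.
move=> /shift_graphE gE; exists (U g); last by rewrite /= /U /Ustar rescaleK.
exists (U f) => //= v; rewrite sumE -gE /= /rescale_fun.
by rewrite mul1r.
Qed.

End Shift.

(** * The unitary equivalence *)

Theorem theorem3p11 (R : realType) (n : nat) (V : set 'X_{1..n})
    (V_neq0 : V !=set0)
    (E : 'I_n -> set (V * V)) (m : 'I_n -> nat)
    (E_class : forall i, semi_tree_class (E i) (m i))
    (k : nat) (k_gt0 : (0 < k)%N)
    (Par_le : forall i v, Par (E i) v #<= `I_k)
    (S : V -> {mpoly R[i][n]})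
    (S_span : forall v, exists c : 'X_{1..n} -> R[i],
       S v = \sum_(a : 'X_{1..n < (mdeg (val v)).+1})
               c a *: \prod_(i < n) assoc_poly R (E i) ^+ a i)
    (S_mul : forall i v,
       assoc_poly R (E i) * S v = \sum_(u \in Chi (E i) v) S u)
    (beta : V -> R) (beta_gt0 : forall v, 0 < beta v)
    (Lambda : 'I_n -> {linear l2 R V -> l2 R V})
    (Lambda_bounded : forall i, bounded_op (Lambda i))
    (Lambda_extends : forall i,
       shift_graph beta (E i) `<=` op_graph (Lambda i))
    (Lambda_comm : forall i j f, Lambda i (Lambda j f) = Lambda j (Lambda i f)) :
  exists (U : {linear l2 R V -> H2 beta}) (Ustar : {linear H2 beta -> l2 R V}),
    unitary U Ustar /\
    forall i,
      let conj_mul :=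
        (op_graph Ustar \; mul_graph beta (E i) \; op_graph U)%relation in
      conj_mul = shift_graph beta (E i) /\ conj_mul = op_graph (Lambda i).
Proof.
have beta_neq0 v : beta v != 0 by rewrite gt_eqF.
have one_neq0 (_ : V) : (1 : R) != 0 by exact: oner_neq0.
pose U : {linear l2 R V -> H2 beta} := rescale (w := fun=> 1) beta_neq0.
pose Ustar : {linear H2 beta -> l2 R V} := rescale (w := beta) one_neq0.
exists U, Ustar; split; first exact: rescale_unitary.
move=> i conj_mul.
have conjE : conj_mul = shift_graph beta (E i) by exact: rescale_mul_graph.
split => //; rewrite conjE; apply: shift_graph_of_bounded.
- by move=> v; apply/finite_set_leP; exists k.
- have [_ _ [d [[_ Chi_le _] _ _]]] := E_class i.
  by move=> v; apply/finite_set_leP; exists d.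
- exact: Lambda_bounded.
- exact: Lambda_extends.
Qed.
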